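(* Let $E$ be a separable Banach space over $K$ with dual $E^*$, let $X$ be an $E$-valued $K$-Gaussian random variable, and set $$S=\{x\in E:|T(x)|\le\|T(X)\|_\infty\ \text{for all }T\in E^*\}.$$ Then: (i) $S$ is a $D$-submodule of $E$. (ii) If $x\in S$ then $x+X$ has the same law as $X$; if $x\notin S$ then the laws of $x+X$ and $X$ are mutually singular. (iii) $S$ is the closed support of the law of $X$. (iv) $S$ is compact. (v) The law of $X$ is normalised Haar measure on $S$. (vi) If $M$ is a measurable vector subspace of $E$, then $\mathbb{P}\{X\in M\}$ equals $1$ if $S\subset M$ and equals $0$ otherwise.
   Context: $K$ is a local field (locally compact, non-discrete, totally disconnected topological field) with its non-archimedean absolute value $|\cdot|$ ($|x|=0\iff x=0$, $|xy|=|x||y|$, $|x+y|\le|x|\vee|y|$); $D=\{x\in K:|x|\le1\}$. A normed space over $K$ is a $K$-vector space $E$ with $\|\cdot\|:E\to[0,\infty)$, $\|x\|=0\iff x=0$, $\|\alpha x\|=|\alpha|\|x\|$, $\|x+y\|\le\|x\|\vee\|y\|$; a Banach space if complete. $E^*$ is the space of continuous $K$-linear functionals $E\to K$. For a $K$-valued random variable $Y$, $\|Y\|_\infty$ is the essential supremum of $|Y|$. $K^2$ is normed by $|(x_1,x_2)|=|x_1|\vee|x_2|$; $v_1,v_2\in K^2$ are orthonormal if $|v_1|=|v_2|=1$ and $|\alpha_1v_1+\alpha_2v_2|=|\alpha_1|\vee|\alpha_2|$ for all $\alpha_i\in K$. An $E$-valued random variable $X$ is $K$-Gaussian if whenever $X_1,X_2$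 are independent copies of $X$ and $(\alpha_{11},\alpha_{12}),(\alpha_{21},\alpha_{22})\in K^2$ are orthonormal, $(\alpha_{11}X_1+\alpha_{12}X_2,\alpha_{21}X_1+\alpha_{22}X_2)$ has the same law as $(X_1,X_2)$. A measurable vector subspace is a $K$-linear subspace that is a Borel set. *)

(* Defs.v *)
From Stdlib Require Lists.List.
From HB Require Import structures.
From mathcomp Require Import all_boot all_order all_algebra.
From mathcomp Require Import all_classical all_reals all_analysis.
From mathcomp Require Import ess_sup_inf.
Set Implicit Arguments. Unset Strict Implicit. Unset Printing Implicit Defensive.
Import Order.TTheory GRing.Theory Num.Theory.
Local Open Scope classical_set_scope.
Local Open Scope ring_scope.

Section Metric.
Context {R : realType} {T : Type} (dist : T -> T -> R).

Definition mopen (A : set T) : Prop :=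
  forall x, A x -> exists r : R, 0 < r /\ (forall y, dist x y < r -> A y).

Definition mclosed (A : set T) : Prop := mopen (~` A).

Definition mcompact (A : set T) : Prop :=
  forall (I : Type) (U : I -> set T), (forall i, mopen (U i)) ->
    (forall x, A x -> exists i, U i x) ->
    exists s : seq I, forall x, A x -> exists i, Stdlib.Lists.List.In i s /\ U i x.

Definition mcomplete : Prop :=
  forall u : nat -> T,
    (forall e : R, 0 < e -> exists N, forall m n, (N <= m)%N -> (N <= n)%N ->
        dist (u m) (u n) < e) ->
    exists l, forall e : R, 0 < e -> exists N, forall n, (N <= n)%N -> dist (u n) l < e.

(* existence of a countable dense subset (the space is nonempty) *)
Definition mseparable : Prop :=
  exists u : nat -> T, forall x (e : R), 0 < e -> exists n, dist x (u n) < e.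

Definition mborel : set (set T) := smallest (sigma_algebra setT) mopen.

End Metric.

Section LocalField.
Context {R : realType} {K : fieldType} (absK : K -> R).

Definition distK (x y : K) : R := absK (x - y).

Definition na_abs_value : Prop :=
  (forall x, 0 <= absK x) /\
  (forall x, absK x = 0 <-> x = 0) /\
  (forall x y, absK (x * y) = absK x * absK y) /\
  (forall x y, absK (x + y) <= Num.max (absK x) (absK y)).

(* K is a local field: its (non-archimedean) absolute value induces a locally
   compact, non-discrete topology (total disconnectedness and Hausdorffness
   follow from the ultrametric inequality). *)
Definition local_field : Prop :=
  na_abs_value /\
  (forall x : K, exists r : R, 0 < r /\ exists C : set K,
      mcompact distK C /\ (forall y, distK x y < r -> C y)) /\
  ~ (forall A : set K, mopen distK A).

Definition normK2 (v : K * K) : R := Num.max (absK v.1) (absK v.2).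

Definition orthonormalK2 (v1 v2 : K * K) : Prop :=
  normK2 v1 = 1 /\ normK2 v2 = 1 /\
  forall b1 b2 : K, normK2 (b1 * v1.1 + b2 * v2.1, b1 * v1.2 + b2 * v2.2)
                    = Num.max (absK b1) (absK b2).

End LocalField.

Section NormedSpace.
Context {R : realType} {K : fieldType} (absK : K -> R) {E : lmodType K}
        (normE : E -> R).

Definition distE (x y : E) : R := normE (x - y).

Definition na_normed_space : Prop :=
  (forall x, 0 <= normE x) /\
  (forall x, normE x = 0 <-> x = 0) /\
  (forall (a : K) x, normE (a *: x) = absK a * normE x) /\
  (forall x y, normE (x + y) <= Num.max (normE x) (normE y)).

Definition separable_banach : Prop :=
  na_normed_space /\ mcomplete distE /\ mseparable distE.

Definition borelE : set (set E) := mborel distE.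

(* Borel sigma-algebra of E x E (product sigma-algebra; E is separable) *)
Definition borelE2 : set (set (E * E)) :=
  smallest (sigma_algebra setT)
    [set C | exists A B, borelE A /\ borelE B /\ C = A `*` B].

Definition in_dual (T : E -> K) : Prop :=
  (forall (a : K) x y, T (a *: x + y) = a * T x + T y) /\
  (forall x (e : R), 0 < e -> exists del : R, 0 < del /\
      forall y, normE (x - y) < del -> absK (T x - T y) < e).

Definition D_submodule (S : set E) : Prop :=
  S 0 /\ (forall x y, S x -> S y -> S (x + y)) /\
  (forall (a : K) x, absK a <= 1 -> S x -> S (a *: x)).

Definition measurable_vsubspace (M : set E) : Prop :=
  M 0 /\ (forall (a : K) x y, M x -> M y -> M (a *: x + y)) /\ borelE M.

Definition random_var {d} {Om : measurableType d} (X : Om -> E) : Prop :=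
  forall B, borelE B -> measurable (X @^-1` B).

Definition law {d} {Om : measurableType d} (P : probability Om R) (X : Om -> E)
  : set E -> \bar R := fun B => P (X @^-1` B).

Definition same_law {d1 d2} {Om1 : measurableType d1} {Om2 : measurableType d2}
  (P1 : probability Om1 R) (X1 : Om1 -> E)
  (P2 : probability Om2 R) (X2 : Om2 -> E) : Prop :=
  forall B, borelE B -> law P1 X1 B = law P2 X2 B.

Definition mutually_singular (mu nu : set E -> \bar R) : Prop :=
  exists B, borelE B /\ mu B = 0%E /\ nu (~` B) = 0%E.

Definition indep2 {d} {Om : measurableType d} (P : probability Om R)
  (X1 X2 : Om -> E) : Prop :=
  forall A B, borelE A -> borelE B ->
    P (X1 @^-1` A `&` X2 @^-1` B) = (P (X1 @^-1` A) * P (X2 @^-1` B))%E.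

Definition K_gaussian {d} {Om : measurableType d} (P : probability Om R)
  (X : Om -> E) : Prop :=
  forall (d' : measure_display) (Om' : measurableType d') (P' : probability Om' R)
         (X1 X2 : Om' -> E),
    random_var X1 -> random_var X2 ->
    same_law P' X1 P X -> same_law P' X2 P X -> indep2 P' X1 X2 ->
    forall a11 a12 a21 a22 : K,
      orthonormalK2 absK (a11, a12) (a21, a22) ->
      forall C, borelE2 C ->
        P' ((fun w => (a11 *: X1 w + a12 *: X2 w, a21 *: X1 w + a22 *: X2 w))
              @^-1` C)
        = P' ((fun w => (X1 w, X2 w)) @^-1` C).

Definition gaussS {d} {Om : measurableType d} (P : probability Om R)
  (X : Om -> E) : set E :=
  [set x | forall T : E -> K, in_dual T ->
     ((absK (T x))%:E <= ess_sup P (fun w => (absK (T (X w)))%:E))%E].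

Definition closed_support {d} {Om : measurableType d} (P : probability Om R)
  (X : Om -> E) : set E :=
  [set x | forall U, mopen distE U -> U x -> (0 < law P X U)%E].

Definition is_normalised_haar_on {d} {Om : measurableType d}
  (P : probability Om R) (X : Om -> E) (S : set E) : Prop :=
  law P X S = 1%E /\
  forall s, S s -> forall B, borelE B -> B `<=` S ->
    law P X ((fun b => s + b) @` B) = law P X B.

End NormedSpace.

(* Main.v *)
(* Let mu be the law of X, with closed support S0. For |a| <= 1 the vectors (1,0)
   and (a,1) are orthonormal, so (X1, a X1 + X2) has the law of (X1, X2).
   Restricting X1 to a small ball around x0 in S0 shows that translating by a x0
   preserves the mu-mass of every ball; in an ultrametric space the balls form a
   pi-system, so mu is invariant under a x0. Hence S0 is a D-module which is
   exactly the group of invariance of mu. Disjoint cosets have equal mass, which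
   gives compactness of S0 and the zero-one law for subspaces. Finally S = S0
   because a point outside an open D-module is separated from it by a functional:
   if W is a maximal open D-submodule avoiding x and p is a uniformizer, then
   E = K x + p^n W for all n, and the coefficients of x converge in K. *)
Require Import Defs.
From HB Require Import structures.
From mathcomp Require Import all_boot all_order all_algebra.
From mathcomp Require Import all_classical all_reals all_analysis.
From mathcomp Require Import ess_sup_inf.
Import Order.TTheory GRing.Theory Num.Theory.
Local Open Scope classical_set_scope.
Local Open Scope ring_scope.
Set Implicit Arguments. Unset Strict Implicit. Unset Printing Implicit Defensive.

(** * Powers tending to zero and the calculus of a non-archimedean absolute value *)

Lemma exists_expr_lt {R : realType} (a r : R) : 0 <= a -> a < 1 -> 0 < r ->
  exists n, a ^+ n < r.
Proof.
move=> a0 a1 r0; have h : `|a| < 1 by rewrite ger0_norm.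
have /cvgr0Pnorm_lt /(_ r r0)[N _ /(_ N (leqnn N)) /= hN] := cvg_expr h.
by exists N; exact: le_lt_trans (ler_norm _) hN.
Qed.

Section NonArchimedeanAbs.
Context {R : realType} {K : fieldType} (absK : K -> R).
Hypothesis HK : na_abs_value absK.

Lemma abs_ge0 x : 0 <= absK x. Proof. by case: HK => + _; exact. Qed.

Lemma absM x y : absK (x * y) = absK x * absK y.
Proof. by case: HK => _ [_ [+ _]]; exact. Qed.

Lemma abs_eq0 x : (absK x == 0) = (x == 0).
Proof.
case: HK => _ [h _]; apply/eqP/eqP => [|->]; first by move/h.
exact/h.
Qed.

Lemma abs0 : absK 0 = 0. Proof. by apply/eqP; rewrite abs_eq0. Qed.

Lemma abs_gt0 x : (0 < absK x) = (x != 0).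
Proof. by rewrite lt_def abs_eq0 abs_ge0 andbT. Qed.

Lemma abs1 : absK 1 = 1.
Proof.
have h : absK 1 != 0 by rewrite abs_eq0 oner_eq0.
by apply: (mulfI h); rewrite -absM !mulr1.
Qed.

Lemma absN1 : absK (-1) = 1.
Proof.
apply/eqP; rewrite -(@eqrXn2 _ 2)// ?abs_ge0//.
by rewrite expr2 -absM mulrNN mulr1 abs1 expr1n.
Qed.

Lemma absN x : absK (- x) = absK x.
Proof. by rewrite -mulN1r absM absN1 mul1r. Qed.

Lemma abs_distC x y : absK (x - y) = absK (y - x).
Proof. by rewrite -absN opprB. Qed.

Lemma absX x n : absK (x ^+ n) = absK x ^+ n.
Proof. by elim: n => [|n IH]; rewrite ?expr0 ?abs1// !exprS absM IH. Qed.

Lemma absV x : absK x^-1 = (absK x)^-1.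
Proof.
have [->|x0] := eqVneq x 0; first by rewrite invr0 abs0 invr0.
have h : absK x != 0 by rewrite abs_eq0.
by apply: (mulfI h); rewrite -absM !mulfV// abs1.
Qed.

Lemma absD_max x y : absK (x + y) <= Num.max (absK x) (absK y).
Proof. by case: HK => _ [_ [_ +]]; exact. Qed.

Lemma absD_lt x y r : absK x < r -> absK y < r -> absK (x + y) < r.
Proof. by move=> hx hy; rewrite (le_lt_trans (absD_max _ _))// gt_max hx. Qed.

Lemma absD_le x y r : absK x <= r -> absK y <= r -> absK (x + y) <= r.
Proof. by move=> hx hy; rewrite (le_trans (absD_max _ _))// ge_max hx. Qed.

(** Used to show that sets cut out by a lower bound on the absolute value are open. *)
Lemma abs_ge_near x y r : r <= absK x -> absK (x - y) < r -> r <= absK y.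
Proof.
move=> rx xy; rewrite leNgt; apply/negP => yr.
by have := absD_lt xy yr; rewrite subrK ltNge rx.
Qed.

End NonArchimedeanAbs.

(** * Local fields: uniformizer and convergence of nested balls *)

Section LocalFieldTheory.
Context {R : realType} {K : fieldType} (absK : K -> R).
Hypothesis HL : local_field absK.
Let HK : na_abs_value absK. Proof. by case: HL. Qed.

(** Otherwise the open unit balls would be single points and the topology discrete. *)
Lemma exists_abs_lt1 : exists a : K, 0 < absK a < 1.
Proof.
apply: contrapT => nex; case: HL => _ [_]; apply => A x Ax.
exists 1; split=> // y; rewrite /distK => xy.
suff /eqP : x - y = 0 by rewrite subr_eq0 => /eqP <-.
apply: contrapT => /eqP xy0; apply: nex; exists (x - y).
by rewrite abs_gt0 // xy0.
Qed.

Lemma exists_abs_lt (r : R) : 0 < r -> exists a : K, 0 < absK a < r.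
Proof.
move=> r0; have [a /andP[a0 a1]] := exists_abs_lt1.
have [n ar] := exists_expr_lt (ltW a0) a1 r0.
by exists (a ^+ n); rewrite absX// exprn_gt0.
Qed.

Lemma exists_compact_ball : exists (a : K) (C : set K), [/\ a != 0,
  mcompact (distK absK) C & forall y, absK y < absK a -> C y].
Proof.
case: HL => _ [/(_ 0)[r [r0 [C [cC hC]]]] _].
have [a /andP[a0 ar]] := @exists_abs_lt r r0.
exists a, C; split=> //; first by rewrite -(abs_gt0 HK).
by move=> y ya; apply: hC; rewrite /distK sub0r absN// (lt_trans ya).
Qed.

(* Compactness makes the value group discrete: cover the maximal ideal by the
   balls [|y| <= |b|], [|b| < 1]. *)
Lemma exists_uniformizer :
  exists p : K, 0 < absK p < 1 /\ forall z, absK z < 1 -> absK z <= absK p.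
Proof.
have [a [C [a0 cC hC]]] := exists_compact_ball.
have aa0 : 0 < absK a by rewrite abs_gt0.
(* Everything is scaled by [a], so that the ball lies in [C]. Indices outside the range receive the
   complement of that ball, which is open too and covers the rest of [C]. *)
pose U (b : K) := if 0 < absK b < absK a then [set y | absK y <= absK b]
                  else [set y | absK a <= absK y].
have oU b : mopen (distK absK) (U b).
  rewrite /U; case: ifPn => [/andP[b0 ba] x xb|_ x xa].
    exists (absK b); split=> // y xy /=.
    by rewrite -(subrK x y) absD_le// abs_distC// ltW.
  exists (absK a); split=> // y xy /=; exact: abs_ge_near xa xy.
have cover x : C x -> exists b, U b x.
  move=> _; have [xa|ax] := ltP (absK x) (absK a); last first.
    by exists 0; rewrite /U abs0 // ltxx.
  have [->|x0] := eqVneq x 0.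
    have [b ba] := exists_abs_lt aa0.
    by exists b; rewrite /U ba/= abs0// ltW//; case/andP: ba.
  by exists x; rewrite /U abs_gt0// x0 xa /=.
have [s hs] := cC _ U oU cover.
(* [b] dominates all admissible radii of the finite subcover; the induction starts from 0. *)
have [b [ba hb]] : exists b, absK b < absK a /\ forall x, List.In x s ->
    0 < absK x < absK a -> absK x <= absK b.
  elim: {hs} s => [|x s [b [ba hb]]]; first by exists 0; rewrite abs0.
  have [/andP[x0 xa]|nx] := boolP (0 < absK x < absK a); last first.
    exists b; split=> // y [<-|]; [by rewrite (negbTE nx)|exact: hb].
  have [bx|xb] := leP (absK b) (absK x).
    exists x; split=> // y [<-//|ys yy]; exact: le_trans (hb _ ys yy) bx.
  by exists b; split=> // y [<-_|]; [exact: ltW|exact: hb].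
have key z : absK z < 1 -> absK z <= absK (b / a).
  move=> z1; rewrite absM// absV// ler_pdivlMr// -absM//.
  have za : absK (z * a) < absK a by rewrite absM// gtr_pMl.
  have [c [cs]] := hs _ (hC _ za).
  rewrite /U; case: ifPn => [cc /= zc|_ /=]; last by rewrite leNgt za.
  exact: le_trans zc (hb _ cs cc).
exists (b / a); split=> //.
have [z /andP[z0 z1]] := exists_abs_lt1.
rewrite (lt_le_trans z0 (key _ z1))/= absM// absV//.
by rewrite ltr_pdivrMr// mul1r.
Qed.

(** Without a common point the complements of the balls, rescaled into a compact set, would form an
    open cover. The centre of a late enough ball escapes any finite subfamily. *)
Lemma nested_balls (p : K) (c : nat -> K) : 0 < absK p < 1 ->
  (forall m n, (m <= n)%N -> absK (c n - c m) < absK p ^+ m) ->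
  exists l, forall n, absK (l - c n) < absK p ^+ n.
Proof.
move=> /andP[p0 p1] hc; have [a [C [a0 cC hC]]] := exists_compact_ball.
have aa0 : 0 < absK a by rewrite abs_gt0.
pose z n := a * (c n - c 0%N).
pose U n := [set x | absK a * absK p ^+ n <= absK (x - z n)].
apply: contrapT => nex.
have oU n : mopen (distK absK) (U n).
  move=> x xU; exists (absK a * absK p ^+ n); split.
    by rewrite mulr_gt0// exprn_gt0.
  move=> y xy /=; apply: (abs_ge_near HK xU).
  by rewrite opprB addrA subrK.
have cover x : C x -> exists n, U n x.
  move=> Cx; apply: contrapT => nU; apply: nex.
  (* Undoing the affine change [z n = a * (c n - c 0)] turns an uncovered point into the required
     limit. *)
  exists (x / a + c 0%N) => n; rewrite ltNge; apply/negP => h.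
  apply: nU; exists n; rewrite /U/= /z.
  have -> : x - a * (c n - c 0%N) = a * (x / a + c 0%N - c n).
    by rewrite !mulrBr mulrDr mulrCA mulfV// mulr1 opprB addrA.
  by rewrite absM// ler_pM2l.
have [s hs] := cC _ U oU cover.
pose N := (\max_(i <- s) i)%N.
have [|n [ns]] := hs (z N).
  by apply: hC; rewrite absM// gtr_pMr// (lt_le_trans (hc 0%N _ _)).
rewrite /U /= leNgt => /negP; apply.
rewrite /z -mulrBr opprB addrA subrK absM// ltr_pM2l//.
have nN : (n <= N)%N.
  rewrite /N; elim: {N hs} s ns => //= m s IH [->|/IH h]; rewrite big_cons.
    exact: leq_maxl.
  by rewrite (leq_trans h) ?leq_maxr.
exact: hc.
Qed.

End LocalFieldTheory.

(** * Ultrametric norms *)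

Section NormedSpaceTheory.
Context {R : realType} {K : fieldType} (absK : K -> R) {E : lmodType K}
        (normE : E -> R).
Hypothesis HK : na_abs_value absK.
Hypothesis HN : na_normed_space absK normE.

Lemma norm_ge0 x : 0 <= normE x. Proof. by case: HN => + _; exact. Qed.

Lemma norm0 : normE 0 = 0.
Proof. by case: HN => _ [h _]; apply/h. Qed.

Lemma normZ a x : normE (a *: x) = absK a * normE x.
Proof. by case: HN => _ [_ [+ _]]; exact. Qed.

Lemma normN x : normE (- x) = normE x.
Proof. by rewrite -scaleN1r normZ absN1// mul1r. Qed.

Lemma norm_distC x y : normE (x - y) = normE (y - x).
Proof. by rewrite -normN opprB. Qed.

Lemma normD_lt x y r : normE x < r -> normE y < r -> normE (x + y) < r.
Proof.
case: HN => _ [_ [_ h]] hx hy; rewrite (le_lt_trans (h x y))//.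
by rewrite gt_max hx.
Qed.

Lemma dist_lt_trans y x z r :
  normE (x - y) < r -> normE (y - z) < r -> normE (x - z) < r.
Proof. by move=> xy yz; rewrite -(subrKA y) normD_lt. Qed.

End NormedSpaceTheory.

(** * Separating a point from an open D-module by a continuous functional *)

Section Separation.
Context {R : realType} {K : fieldType} (absK : K -> R) {E : lmodType K}
        (normE : E -> R).
Hypothesis HL : local_field absK.
Hypothesis HN : na_normed_space absK normE.
Let HK : na_abs_value absK. Proof. by case: HL. Qed.

Lemma submoduleB (W : set E) : D_submodule absK W ->
  forall x y, W x -> W y -> W (x - y).
Proof.
move=> [_ [WD WZ]] x y Wx Wy; apply: WD => //.
by rewrite -scaleN1r; apply: WZ => //; rewrite absN1.
Qed.

(** Zorn's lemma: the union of a nonempty chain of submodules containing [V] and avoiding [x] is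
    again one. *)
Lemma maximal_submodule (V : set E) (x : E) : D_submodule absK V -> ~ V x ->
  exists W, [/\ D_submodule absK W, V `<=` W, ~ W x &
    forall W', D_submodule absK W' -> W `<=` W' -> ~ W' x -> W' `<=` W].
Proof.
move=> mV Vx.
pose good W := [/\ D_submodule absK W, V `<=` W & ~ W x].
(* The empty set is admitted for the sake of the empty chain. *)
have [F FP Ftot|W [[W0|[mW VW Wx]] maxW]] :=
    @Zorn_bigcup E (fun W => W `<=` set0 \/ good W).
- have [[W0 FW0 W0n0]|nF] :=
      pselect (exists2 W, F W & exists y, W y); last first.
    by left=> y [W FW Wy]; apply: nF; exists W => //; exists y.
  have gF W y : F W -> W y -> good W.
    by move=> /FP[W0'|//] Wy; have := W0' _ Wy.
  have [y0 W0y0] := W0n0; have [[W00 _] VW0 _] := gF _ _ FW0 W0y0.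
  right; split.
  + split; first by exists W0.
    split=> [y z [W1 F1 W1y] [W2 F2 W2z]|a y a1 [W1 F1 W1y]].
      have [W12|W21] := Ftot _ _ F1 F2.
        have [[_ [WD _]] _ _] := gF _ _ F2 W2z.
        by exists W2 => //; apply: WD => //; exact: W12.
      have [[_ [WD _]] _ _] := gF _ _ F1 W1y.
      by exists W1 => //; apply: WD => //; exact: W21.
    have [[_ [_ WZ]] _ _] := gF _ _ F1 W1y.
    by exists W1 => //; exact: WZ.
  + by move=> y Vy; exists W0 => //; exact: VW0.
  + by move=> [W1 F1 W1x]; case: (gF _ _ F1 W1x) => _ _; apply.
(* An empty [W] is not maximal, since [V] is larger and admissible. *)
- exfalso; apply: (maxW V _ (or_intror (And3 mV (@subset_refl _ V) Vx))).
  split=> [y /W0|VW]; first by [].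

  by case: mV => /VW /W0.
- exists W; split=> // W' mW' WW' W'x; apply: contrapT => nW'W.
  apply: (maxW W'); first by split.
  by right; split=> // y /VW/WW'.
Qed.

Section MaximalSubmodule.
Variables (p : K) (W : set E) (x : E) (e : R).
Hypothesis p01 : 0 < absK p < 1.
Hypothesis p_unif : forall z, absK z < 1 -> absK z <= absK p.
Hypothesis mW : D_submodule absK W.
Hypothesis Wx : ~ W x.
Hypothesis maxW : forall W',
  D_submodule absK W' -> W `<=` W' -> ~ W' x -> W' `<=` W.
Hypothesis e_gt0 : 0 < e.
Hypothesis ballW : forall y, normE y < e -> W y.

Let W0 : W 0. Proof. by case: mW. Qed.
Let WD y z : W y -> W z -> W (y + z). Proof. by case: mW => _ [+ _]; exact. Qed.
Let WZ a y : absK a <= 1 -> W y -> W (a *: y).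
Proof. by case: mW => _ [_]; exact. Qed.
Let p0 : p != 0. Proof. by rewrite -(abs_gt0 HK); case/andP: p01. Qed.

(** The submodule W + D y is strictly larger than [W], so by maximality it contains [x]. *)
Lemma maximal_submodule_span y : ~ W y ->
  exists w d, [/\ W w, absK d <= 1 & x = w + d *: y].
Proof.
move=> Wy; apply: contrapT => nx; apply: Wy.
pose W' := [set z | exists w d, [/\ W w, absK d <= 1 & z = w + d *: y]].
apply: (maxW (W' := W')) => //.
- split; first by exists 0, 0; rewrite abs0// ler01 scale0r addr0.
  split=> [_ _ [w1 [d1 [W1 D1 ->]]] [w2 [d2 [W2 D2 ->]]]|].
    exists (w1 + w2), (d1 + d2); split; [exact: WD|exact: absD_le|].
    by rewrite scalerDl addrACA.
  move=> a _ a1 [w1 [d1 [W1 D1 ->]]].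
  exists (a *: w1), (a * d1); split; first exact: WZ.
    by rewrite absM// mulr_ile1// abs_ge0.
  by rewrite scalerDr scalerA.
- by move=> w Ww; exists w, 0; rewrite abs0// ler01 scale0r addr0.
- by exists 0, 1; rewrite abs1// lexx scale1r add0r.
Qed.

(** This determines the trace of [W] on the line K x, and converts membership in [W] into bounds on
    coefficients of [x]. *)
Lemma maximal_submodule_scale a : W (a *: x) <-> absK a < 1.
Proof.
have Wa_lt1 b : W (b *: x) -> absK b < 1.
  move=> Wb; rewrite ltNge; apply/negP => b1; apply: Wx.
  have b0 : b != 0 by rewrite -(abs_gt0 HK) (lt_le_trans ltr01).
  rewrite -[x]scale1r -(mulVf b0) -scalerA; apply: WZ => //.
  by rewrite absV// invf_le1// (lt_le_trans ltr01).
split=> [|a1]; first exact: Wa_lt1.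
suff Wp : W (p *: x).
  rewrite -[a](divfK p0) -scalerA; apply: WZ => //.
  by rewrite absM// absV// ler_pdivrMr ?mul1r ?p_unif//; case/andP: p01.
(* If p x is not in [W], then x = w + d p x, so (1 - d p) x lies in [W]. Hence |1 - d p| < 1, and |d
   p| < 1 then forces |1| < 1. *)
apply: contrapT => /maximal_submodule_span[w [d [Ww d1 xE]]].
have /Wa_lt1 : W ((1 - d * p) *: x).
  by rewrite scalerBl scale1r -scalerA {1}xE addrK.
have dp : absK (d * p) < 1.
  case/andP: p01 => _; apply: le_lt_trans.
  by rewrite absM// ler_piMl// abs_ge0.
by move=> /(absD_lt HK) /(_ dp); rewrite subrK abs1// ltxx.
Qed.

(** Induction on [k]: subtracting a suitable multiple of [x] from [y] lowers by one the power of [p]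
    needed to reach [W]. *)
Lemma maximal_submodule_complement k y : W (p ^+ k *: y) ->
  exists c, W (y - c *: x).
Proof.
elim: k y => [|k IH] y.
  by rewrite expr0 scale1r => Wy; exists 0; rewrite scale0r subr0.
move=> Wpy; have [/IH//|/maximal_submodule_span[w [d [Ww d1 xE]]]] :=
  pselect (W (p ^+ k *: y)).
(* If |d| < 1, then d p^k y is a D-multiple of p^(k+1) y, hence in [W], and so is x. *)
have dd : absK d = 1.
  apply/eqP; rewrite eq_le d1 leNgt; apply/negP => dlt; apply: Wx.
  rewrite xE; apply: WD => //.
  rewrite -[d](divfK p0) -scalerA [p *: _]scalerA -exprS; apply: WZ => //.
  by rewrite absM// absV// ler_pdivrMr ?mul1r ?p_unif//; case/andP: p01.
have d0 : d != 0 by rewrite -(abs_gt0 HK) dd.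
have pk0 : p ^+ k != 0 by rewrite expf_neq0.
(* With this choice p^k (y - c0 x) = - d^-1 w, which lies in [W] because [d] is a unit of D. *)
pose c0 := p ^- k * d^-1.
have [|c Wc] := IH (y - c0 *: x).
  rewrite scalerBr scalerA /c0 mulrA mulfV// mul1r {1}xE scalerDr (scalerA d^-1).
  rewrite mulVf// scale1r opprD addrCA subrr addr0 -scalerN.
  apply: WZ; first by rewrite absV// dd invr1.
  by rewrite -scaleN1r; apply: WZ => //; rewrite absN1.
by exists (c0 + c); rewrite scalerDl opprD addrA.
Qed.

(** At each level [n] a coefficient [c n] exists. Two of them differ by less than |p|^m for m the
    smaller level, so they converge in K, and the limit serves all levels. *)
Lemma maximal_submodule_quotient y : exists l, forall n, W (p ^- n *: (y - l *: x)).
Proof.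
have [p_gt0 p_lt1] := andP p01.
have pX n : p ^+ n != 0 by rewrite expf_neq0.
have hc n : exists c, W (p ^- n *: (y - c *: x)).
  (* [W] contains a ball, so it absorbs every vector; adding 1 to the norm avoids a division by
     zero. *)
  have [k hk] : exists k, W (p ^+ k *: (p ^- n *: y)).
    have h : 0 < e / (1 + normE (p ^- n *: y)).
      by rewrite divr_gt0// (lt_le_trans ltr01)// lerDl (norm_ge0 HN).
    have [k hk] := exists_expr_lt (ltW p_gt0) p_lt1 h.
    exists k; apply: ballW; rewrite (normZ HN) absX//.
    move: hk; rewrite ltr_pdivlMr; last first.
      by rewrite (lt_le_trans ltr01)// lerDl (norm_ge0 HN).
    apply: le_lt_trans; rewrite ler_pM2l ?exprn_gt0//.
    by rewrite lerDr.
  have [c Wc] := maximal_submodule_complement hk.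
  exists (p ^+ n * c); rewrite scalerBr scalerA mulrA mulVf//.
  by rewrite mul1r.
have /choice[c Wc] := hc.
have [|l hl] := nested_balls HL p01 (c := c).
  move=> m n mn.
  have : W ((p ^- m * (c n - c m)) *: x).
    have -> : (p ^- m * (c n - c m)) *: x =
        p ^- m *: (y - c m *: x) - p ^+ (n - m) *: (p ^- n *: (y - c n *: x)).
      have -> : p ^+ (n - m) *: (p ^- n *: (y - c n *: x)) =
          p ^- m *: (y - c n *: x).
        rewrite scalerA; congr (_ *: _); apply: (mulIf (pX n)).
        by rewrite -mulrA mulVf// mulr1 -{2}(subnK mn) exprD mulrCA mulVf// mulr1.
      rewrite -scalerBr -scalerA; congr (_ *: _).
      by rewrite scalerBl opprB [RHS]addrC addrA subrK.
    apply: submoduleB => //; apply: WZ => //.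
    by rewrite absX// exprn_ile1// ltW.
  move/maximal_submodule_scale; rewrite absM// absV// absX//.
  by rewrite mulrC ltr_pdivrMr ?mul1r// exprn_gt0.
exists l => n.
have -> : y - l *: x = (y - c n *: x) - (l - c n) *: x.
  by rewrite scalerBl opprB addrA subrK.
rewrite scalerBr; apply: submoduleB => //.
rewrite scalerA; apply/maximal_submodule_scale.
rewrite absM// absV// absX//.
by rewrite mulrC ltr_pdivrMr ?mul1r// exprn_gt0.
Qed.

(** [T y] is the coefficient of [x] in [y]. Its uniqueness yields linearity, and its bound on [W],
    which contains a ball, yields continuity. *)
Lemma maximal_submodule_functional : exists T : E -> K,
  [/\ in_dual absK normE T, T x = 1 & forall y, W y -> absK (T y) < 1].
Proof.
have [p_gt0 p_lt1] := andP p01.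
have /choice[T hT] := maximal_submodule_quotient.
have Tuniq y l : (forall n, W (p ^- n *: (y - l *: x))) -> T y = l.
  move=> hl; apply/eqP; rewrite -subr_eq0 -(abs_eq0 HK).
  apply/negPn/negP => dl.
  have d0 : 0 < absK (T y - l) by rewrite lt_def dl abs_ge0.
  have [n] := exists_expr_lt (ltW p_gt0) p_lt1 d0.
  rewrite ltNge => /negP; apply; apply: ltW.
  have : W ((p ^- n * (T y - l)) *: x).
    have -> : (p ^- n * (T y - l)) *: x =
        p ^- n *: (y - l *: x) - p ^- n *: (y - T y *: x).
      rewrite -scalerBr -scalerA; congr (_ *: _).
      by rewrite scalerBl opprB [RHS]addrC addrA subrK.
    exact: submoduleB.
  move/maximal_submodule_scale; rewrite absM// absV// absX//.
  by rewrite mulrC ltr_pdivrMr ?mul1r// exprn_gt0.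
have TW y : W y -> absK (T y) < 1.
  move=> Wy; apply/maximal_submodule_scale.
  rewrite -[_ *: _](subKr y); apply: submoduleB => //.
  by have := hT y 0%N; rewrite expr0 invr1 scale1r.
have Tlin a y z : T (a *: y + z) = a * T y + T z.
  apply: Tuniq => n.
  have -> : a *: y + z - (a * T y + T z) *: x =
      a *: (y - T y *: x) + (z - T z *: x).
    by rewrite scalerDl scalerBr scalerA opprD addrACA.
  rewrite scalerDr; apply: WD => //.
  (* The scalar [a] may lie outside D. Passing from level [n] to [n + m] replaces it by a p^m, which
     lies in D. *)
  have [m] : exists m, absK p ^+ m < (1 + absK a)^-1.
    apply: exists_expr_lt => //; first exact: ltW.
    by rewrite invr_gt0 (lt_le_trans ltr01)// lerDl abs_ge0.
  rewrite -[_^-1]mul1r ltr_pdivlMr; last first.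
    by rewrite (lt_le_trans ltr01)// lerDl abs_ge0.
  move=> hm.
  have -> : p ^- n *: (a *: (y - T y *: x)) =
      (a * p ^+ m) *: (p ^- (n + m) *: (y - T y *: x)).
    rewrite !scalerA; congr (_ *: _); rewrite exprD invfM.
    by rewrite mulrACA mulfV ?expf_neq0// mulr1 mulrC.
  apply: WZ => //; rewrite absM// absX// mulrC.
  apply: ltW; apply: le_lt_trans hm.
  by rewrite ler_pM2l ?exprn_gt0// lerDr.
have TB y z : T (y - z) = T y - T z.
  by rewrite addrC -scaleN1r Tlin mulN1r addrC.
have TZ a y : T (a *: y) = a * T y.
  have T0 : T 0 = 0 by rewrite -(subrr 0) TB subrr.
  by rewrite -[_ *: _]addr0 Tlin T0 addr0.
exists T; split=> //; last by apply: Tuniq => n; rewrite scale1r subrr scaler0.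
split=> // y r r0.
have [m hm] := exists_expr_lt (ltW p_gt0) p_lt1 r0.
have pm : 0 < absK p ^+ m by rewrite exprn_gt0.
(* Within this distance p^-m (y - z) lies in the ball inside [W], so |T (y - z)| < |p|^m < r. *)
exists (e * absK p ^+ m); split; first by rewrite mulr_gt0.
move=> z yz; rewrite -TB; apply: lt_trans hm.
have : absK (T (p ^- m *: (y - z))) < 1.
  by apply/TW/ballW; rewrite (normZ HN) absV// absX// mulrC ltr_pdivrMr.
by rewrite TZ absM// absV// absX// mulrC ltr_pdivrMr ?mul1r.
Qed.

End MaximalSubmodule.

Lemma submodule_separation (V : set E) (x : E) (e : R) :
  D_submodule absK V -> 0 < e -> (forall y, normE y < e -> V y) -> ~ V x ->
  exists T : E -> K,
    [/\ in_dual absK normE T, T x = 1 & forall y, V y -> absK (T y) < 1].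
Proof.
move=> mV e0 ballV Vx; have [p [p01 p_unif]] := exists_uniformizer HL.
have [W [mW VW Wx maxW]] := maximal_submodule mV Vx.
have [T [Td Tx TW]] := maximal_submodule_functional p01 p_unif mW Wx maxW e0
  (fun y ye => VW _ (ballV y ye)).
by exists T; split=> // y /VW/TW.
Qed.

End Separation.

(** * Borel sets and the pi-system of ultrametric balls *)

Section MetricBorel.
Context {R : realType} {T : Type} (dist : T -> T -> R).

Lemma mborel_open A : mopen dist A -> mborel dist A.
Proof. exact: sub_sigma_algebra. Qed.

Lemma mborelC A : mborel dist A -> mborel dist (~` A).
Proof. by move=> /sigma_algebraCD; rewrite setTD. Qed.

Lemma mborel_closed A : mclosed dist A -> mborel dist A.
Proof. by move=> /mborel_open/mborelC; rewrite setCK. Qed.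

Lemma mborel_preimage (f : T -> T) :
  (forall A, mopen dist A -> mopen dist (f @^-1` A)) ->
  forall A, mborel dist A -> mborel dist (f @^-1` A).
Proof.
move=> fopen A; move: A; apply: smallest_sub => [|A /fopen]; last first.
  exact: mborel_open.
split; first exact: sigma_algebra0.
  by move=> A /mborelC; rewrite setTD.
by move=> F hF; rewrite /= preimage_bigcup; exact: sigma_algebra_bigcup.
Qed.

End MetricBorel.

Section UltrametricBalls.
Context {R : realType} {K : fieldType} (absK : K -> R) {E : lmodType K}
        (normE : E -> R).
Hypothesis HK : na_abs_value absK.
Hypothesis HN : na_normed_space absK normE.

Definition uball (c : E) (r : R) : set E := [set y | normE (c - y) < r].

Lemma uball_center c r : 0 < r -> uball c r c.
Proof. by move=> r0; rewrite /uball /= subrr (norm0 HN). Qed.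

(** Every point of an ultrametric ball is a centre of it, so two balls that meet are nested. *)
Lemma uball_sub c d r s z : uball c r z -> uball d s z -> r <= s ->
  uball c r `<=` uball d s.
Proof.
move=> cz dz rs y cy; apply: (dist_lt_trans HN dz).
apply: lt_le_trans rs; apply: (dist_lt_trans HN _ cy).
by rewrite (norm_distC HK HN).
Qed.

Lemma mopen_uball c r : mopen (distE normE) (uball c r).
Proof.
move=> x cx; exists r; split; last first.
  by move=> y xy; exact: (dist_lt_trans HN cx).
exact: le_lt_trans (norm_ge0 HN _) cx.
Qed.

Lemma borel_uball c r : borelE normE (uball c r).
Proof. by apply: mborel_open; exact: mopen_uball. Qed.

Lemma borel_translate (x : E) A : borelE normE A ->
  borelE normE [set y | A (x + y)].
Proof.
apply: mborel_preimage => U oU y /oU[r [r0 hr]]; exists r; split=> // z yz.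
by apply: hr; rewrite /distE opprD addrACA subrr add0r.
Qed.

(** The empty set is included to make the family stable under intersection. *)
Definition uballs : set (set E) := [set A | A = set0 \/ exists c r, A = uball c r].

Lemma setI_closed_uballs : setI_closed uballs.
Proof.
move=> A B [->|[c [r ->]]]; first by left; rewrite set0I.
move=> [->|[d [s ->]]]; first by left; rewrite setI0.
have [[z [cz dz]]|n0] := pselect (exists z, (uball c r `&` uball d s) z).
  have [rs|/ltW sr] := leP r s.
    by right; exists c, r; rewrite setIidl//; exact: (uball_sub cz dz).
  by right; exists d, s; rewrite setIidr//; exact: (uball_sub dz cz).
by left; apply/seteqP; split=> z // cdz; apply: n0; exists z.
Qed.

Hypothesis HS : mseparable (distE normE).

Lemma countable_base : exists B : nat -> set E, (forall k, uballs (B k)) /\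
  forall A x, mopen (distE normE) A -> A x -> exists k, B k x /\ B k `<=` A.
Proof.
have [u hu] := HS.
(* Dyadic balls around the dense sequence, with the empty set at codes that decode to no pair. *)
pose B k := if unpickle k is Some (i, j) then uball (u i) (2^-1 ^+ j) else set0.
exists B; split.
  move=> k; rewrite /B; case: unpickle => [[i j]|]; last by left.
  by right; exists (u i), (2^-1 ^+ j).
move=> A x oA /oA[r [r0 hr]].
have [|||j hj] := @exists_expr_lt R 2^-1 r; rewrite ?invr_ge0// ?invf_lt1 ?ltr1n//.
have [|i hi] := hu x (2^-1 ^+ j); first by rewrite exprn_gt0// invr_gt0.
have ix : uball (u i) (2^-1 ^+ j) x.
  by rewrite /uball /= (norm_distC HK HN).
exists (pickle (i, j)); rewrite /B pickleK; split=> //.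
apply: subset_trans (fun y (xy : uball x r y) => hr y xy).
by apply: uball_sub ix (uball_center _ r0) (ltW hj).
Qed.

(** For a pi-system the generated Dynkin class is a sigma-algebra, and by separability each open set
    is a countable union of balls. *)
Lemma borelE_uballs : borelE normE `<=` <<d uballs >>.
Proof.
rewrite (setI_closed_g_dynkin_g_sigma_algebra setI_closed_uballs).
have [B [hB base]] := countable_base.
apply: smallest_sub => [|A oA]; first exact: smallest_sigma_algebra.
have -> : A = \bigcup_k (if pselect (B k `<=` A) then B k else set0).
  apply/seteqP; split=> [x Ax|x [k _]]; last by case: pselect => // BA; exact: BA.
  by have [k [kx kA]] := base _ _ oA Ax; exists k => //; case: pselect.
apply: sigma_algebra_bigcup => k; apply: sub_sigma_algebra.
by case: pselect => h; [exact: hB|left].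
Qed.

End UltrametricBalls.

(** * Two facts on probabilities: uniqueness on Dynkin classes and disjoint events of equal mass *)

Lemma eq_law_on_dynkin {R : realType} {E : Type} {d} {Om : measurableType d}
    (P : probability Om R) (X Y : Om -> E) (G B : set (set E)) :
  B `<=` <<d G >> ->
  (forall A, G A -> [/\ measurable (X @^-1` A), measurable (Y @^-1` A) &
    P (X @^-1` A) = P (Y @^-1` A)]) ->
  forall A, B A -> P (X @^-1` A) = P (Y @^-1` A).
Proof.
move=> BG eqG A /BG; move: A.
suff: <<d G >> `<=` [set A | [/\ measurable (X @^-1` A), measurable (Y @^-1` A) &
    P (X @^-1` A) = P (Y @^-1` A)]] by move=> h A /h[].
apply: smallest_sub => //; split.
- by split=> //=; rewrite preimage_setT.
- move=> A [mX mY eqXY]; rewrite /= -(preimage_setC X A) -(preimage_setC Y A).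
  split; [exact: measurableC|exact: measurableC|].
  by rewrite !probability_setC// eqXY.
- move=> F tF hF.
  have tri (Z : Om -> E) : trivIset setT (fun k => Z @^-1` F k).
    by move=> i j _ _ [w [wi wj]]; apply: tF => //; exists (Z w).
  have mX k : measurable (X @^-1` F k) by case: (hF k).
  have mY k : measurable (Y @^-1` F k) by case: (hF k).
  rewrite /= (preimage_bigcup _ X F) (preimage_bigcup _ Y F).
  split; [exact: bigcup_measurable|exact: bigcup_measurable|].
  rewrite !measure_bigcup//.
  by apply: eq_eseriesr => k _; case: (hF k).
Qed.

(** Additivity gives n c <= 1 for every n, which is impossible for c > 0. *)
Lemma trivIset_same_probability {R : realType} {d} {Om : measurableType d}
    (P : probability Om R) (F : nat -> set Om) (c : \bar R) :
  (forall n, measurable (F n)) -> trivIset setT F -> (forall n, P (F n) = c) ->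
  c = 0%E.
Proof.
move=> mF tF PF.
have c_ge0 : (0 <= c)%E by rewrite -(PF 0%N).
have c_le1 : (c <= 1)%E by rewrite -(PF 0%N) probability_le1.
have cfin : c \is a fin_num.
  by rewrite ge0_fin_numE// (le_lt_trans c_le1)// ltry.
have hn n : (fine c *+ n <= 1).
  have : (P (\big[setU/set0]_(i < n) F i) <= 1)%E.
    by apply: probability_le1; exact: bigsetU_measurable.
  rewrite measure_bigsetU//.
  have -> : (\sum_(i < n) P (F i) = \sum_(i < n) (fine c)%:E)%E.
    by apply: eq_bigr => i _; rewrite PF fineK.
  by rewrite sumEFin lee_fin sumr_const card_ord.
have : 0 <= fine c by exact: fine_ge0.
rewrite le_eqVlt => /orP[/eqP c0|c_gt0]; first by rewrite -(fineK cfin) -c0.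
have := hn (Num.bound (fine c)^-1); rewrite leNgt => /negP[].
rewrite -mulr_natr -ltr_pdivrMl// mulr1.
by apply: archi_boundP; rewrite invr_ge0 ltW.
Qed.

(** * Compactness of closed totally bounded sets *)

Section TotallyBounded.
Context {R : realType} {K : fieldType} (absK : K -> R) {E : lmodType K}
        (normE : E -> R).
Hypothesis HK : na_abs_value absK.
Hypothesis HN : na_normed_space absK normE.

(** If [S] has no finite subcover, intersecting with ever smaller balls gives nested sets without
    one. They shrink to a point of [S], and one open set around that point swallows a late one of
    them. *)
Lemma totally_bounded_compact (u : nat -> E) (S : set E) :
  mcomplete (distE normE) -> mclosed (distE normE) S ->
  (forall r, 0 < r -> exists N, forall s, S s ->
     exists n, (n < N)%N /\ uball normE (u n) r s) ->
  mcompact (distE normE) S.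
Proof.
move=> cE cS tb I U oU coverU.
pose good A := exists s : seq I, forall x, A x -> exists i, List.In i s /\ U i x.
apply: contrapT => badS.
pose rad k : R := 2^-1 ^+ k.
have rad_gt0 k : 0 < rad k by rewrite exprn_gt0// invr_gt0.
have rad_le m n : (m <= n)%N -> rad n <= rad m.
  by move=> mn; apply: ler_wiXn2l => //; rewrite ?invr_ge0// invf_le1// ler1n.
have refine k A : exists n, A `<=` S -> ~ good A ->
    ~ good (A `&` uball normE (u n) (rad k)).
  have [[AS bA]|nAS] := pselect (A `<=` S /\ ~ good A); last first.
    by exists 0%N => AS bA; case: nAS.
  apply: contrapT => nex.
  have gn n : good (A `&` uball normE (u n) (rad k)).
    by apply: contrapT => bn; apply: nex; exists n.
  have [N hN] := tb _ (rad_gt0 k).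
  apply: bA.
  suff [s hs] : exists s : seq I, forall n x, (n < N)%N -> A x ->
      uball normE (u n) (rad k) x -> exists i, List.In i s /\ U i x.
    by exists s => x Ax; have [n [nN nx]] := hN _ (AS _ Ax); exact: hs nx.
  elim: N {hN} => [|N [s hs]]; first by exists [::].
  have [t ht] := gn N.
  exists (s ++ t) => n x; rewrite ltnS leq_eqVlt => /orP[/eqP ->|nN] Ax nx.
    have [i [it Uix]] := ht x (conj Ax nx).
    by exists i; split=> //; apply: List.in_or_app; right.
  have [i [it Uix]] := hs _ _ nN Ax nx.
  by exists i; split=> //; apply: List.in_or_app; left.
(* The conditions on the set are kept as implications so that the choice function is total and can
   drive a recursion. *)
have /choice[f hf] : forall kA : nat * set E, exists n, kA.2 `<=` S ->
    ~ good kA.2 -> ~ good (kA.2 `&` uball normE (u n) (rad kA.1)).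
  by move=> [k A]; exact: refine.
pose A := fix A k := if k is k'.+1 then
  A k' `&` uball normE (u (f (k', A k'))) (rad k') else S.
have AS k : A k `<=` S by elim: k => //= k IH x [/IH].
have bA k : ~ good (A k) by elim: k => //= k IH; exact: (hf (k, A k) (AS k) IH).
have A_mono m n : (m <= n)%N -> A n `<=` A m.
  elim: n => [|n IH]; first by rewrite leqn0 => /eqP ->.
  rewrite leq_eqVlt => /orP[/eqP -> //|]; rewrite ltnS => /IH mn.
  by move=> x /= [/mn].
have A_dist k x y : A k.+1 x -> A k.+1 y -> normE (x - y) < rad k.
  move=> [_ ux] [_ uy]; apply: (dist_lt_trans HN _ uy).
  by rewrite (norm_distC HK HN).
(* An empty [A k] would be covered by the empty list. *)
have /choice[x hx] : forall k, exists x, A k x.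
  move=> k; apply: contrapT => Ak0; apply: (bA k); exists [::] => x Akx.
  by case: Ak0; exists x.
have half : 0 <= 2^-1 :> R /\ 2^-1 < 1 :> R by rewrite invr_ge0 invf_lt1 ?ltr1n.
have [|l hl] := cE x.
  move=> e e0; have [k ke] := exists_expr_lt half.1 half.2 e0.
  exists k.+1 => m n km kn; apply: lt_trans ke.
  by apply: A_dist; [apply: A_mono (hx m)|apply: A_mono (hx n)].
have Sl : S l.
  apply: contrapT => /cS[r [r0 hr]].
  have [N /(_ N (leqnn N))] := hl _ r0.
  rewrite /distE (norm_distC HK HN) => /hr; apply; exact: AS (hx N).
have [i Uil] := coverU _ Sl.
have [e [e0 he]] := oU i _ Uil.
have [k ke] := exists_expr_lt half.1 half.2 e0.
have [N hN] := hl _ e0.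
apply: (bA k.+1); exists [:: i] => y Ay; exists i; split; first by left.
apply: he; rewrite /distE (norm_distC HK HN).
have xl := hN (maxn N k.+1) (leq_maxl _ _).
apply: (dist_lt_trans HN _ xl); apply: lt_trans ke.
by apply: A_dist => //; apply: A_mono (hx _); exact: leq_maxr.
Qed.

End TotallyBounded.

(** * Gaussian laws: invariance under translation by support points *)

Section GaussianLaw.
Context {R : realType} {K : fieldType} (absK : K -> R) {E : lmodType K}
        (normE : E -> R).
Hypothesis HL : local_field absK.
Hypothesis HE : separable_banach absK normE.
Context {d : measure_display} {Om : measurableType d} (P : probability Om R)
        (X : Om -> E).
Hypothesis HX : random_var normE X.
Hypothesis HG : K_gaussian absK normE P X.

Let HK : na_abs_value absK. Proof. by case: HL. Qed.
Let HN : na_normed_space absK normE. Proof. by case: HE. Qed.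
Let HS : mseparable (distE normE). Proof. by case: HE => _ []. Qed.

Local Notation supp := (closed_support normE P X).
Local Notation ball := (uball normE).

Let mX A : borelE normE A -> measurable (X @^-1` A). Proof. exact: HX. Qed.

Lemma same_law_uballs (f : E -> E) :
  (forall A, borelE normE A -> borelE normE (f @^-1` A)) ->
  (forall c r, P ((f \o X) @^-1` ball c r) = P (X @^-1` ball c r)) ->
  same_law normE P (f \o X) P X.
Proof.
move=> mf hf; apply: eq_law_on_dynkin (borelE_uballs HK HN HS) _.
move=> A [->|[c [r ->]]]; first by rewrite !preimage_set0; split.
have mb : borelE normE (ball c r) by exact: (borel_uball HN).
by split=> //; [apply: (mX (mf _ mb))|exact: mX].
Qed.

(** The combination is (b + c a, c), and |c a| <= |c| makes the term c a invisible in the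
    maximum. *)
Lemma orthonormal_shear a : absK a <= 1 ->
  orthonormalK2 absK (1, 0) (a, 1).
Proof.
move=> a1; rewrite /orthonormalK2 /normK2 /= (abs0 HK) (abs1 HK).
split; first by apply/max_idPl.
split; first by apply/max_idPr.
move=> b c; rewrite !mulr1 mulr0 add0r; apply/eqP; rewrite eq_le !ge_max !le_max.
rewrite !lexx !orbT !andbT /=.
have ca : absK (c * a) <= absK c by rewrite absM// ler_piMr// abs_ge0.
apply/andP; split.
  have := absD_max HK b (c * a); rewrite le_max => /orP[->//|h].
  by rewrite (le_trans h ca) orbT.
have := absD_max HK (b + c * a) (- (c * a)); rewrite addrK le_max absN//.
by move=> /orP[->//|h]; rewrite (le_trans h ca) orbT.
Qed.

(* On [X1] in a ball around [x0] of the radius of the target ball, the events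
   [a X1 + X2 \in ball] and [a x0 + X2 \in ball] coincide, so the invariance of
   the law of [(X1, X2)] only involves rectangles. *)
Lemma support_scale_invariant x0 a : supp x0 -> absK a <= 1 ->
  same_law normE P (fun w => a *: x0 + X w) P X.
Proof.
move=> sx0 a1.
apply: (same_law_uballs (f := fun y => a *: x0 + y)).
  by move=> A; exact: borel_translate.
move=> c r.
have [r0|r0] := leP r 0.
  suff -> : ball c r = set0 by rewrite !preimage_set0.
  apply/seteqP; split=> // y; rewrite /uball /= ltNge => /negP[].
  exact: le_trans r0 (norm_ge0 HN _).
have mb z s : borelE normE (ball z s) by exact: (borel_uball HN).
(* The coordinates of the product space carry two independent copies of [X]. *)
pose P2 : probability (Om * Om)%type R := (P \x P)%E.
have P2E A B : measurable A -> measurable B -> P2 (A `*` B) = (P A * P B)%E.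
  by move=> mA mB; rewrite /P2 /= product_measure1E.
have fstE A : (X \o fst) @^-1` A = (X @^-1` A) `*` [set: Om].
  by apply/seteqP; split=> [[w1 w2]|[w1 w2] []].
have sndE A : (X \o snd) @^-1` A = [set: Om] `*` (X @^-1` A).
  by apply/seteqP; split=> [[w1 w2]|[w1 w2] []].
have PfstE A : borelE normE A -> P2 ((X \o fst) @^-1` A) = P (X @^-1` A).
  move=> mA; rewrite fstE P2E//; last exact: mX.
  by rewrite probability_setT mule1.
have PsndE A : borelE normE A -> P2 ((X \o snd) @^-1` A) = P (X @^-1` A).
  move=> mA; rewrite sndE P2E//; last exact: mX.
  by rewrite probability_setT mul1e.
have rv1 : random_var normE (X \o fst : Om * Om -> E).
  by move=> B mB; rewrite fstE; apply: measurableX => //; exact: mX.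
have rv2 : random_var normE (X \o snd : Om * Om -> E).
  by move=> B mB; rewrite sndE; apply: measurableX => //; exact: mX.
have ind : indep2 normE P2 (X \o fst) (X \o snd).
  move=> A B mA mB; rewrite PfstE// PsndE//.
  rewrite (_ : _ `&` _ = (X @^-1` A) `*` (X @^-1` B)); last first.
    by apply/seteqP; split=> [[w1 w2]|[w1 w2] []].
  by rewrite P2E//; exact: mX.
have mC : borelE2 normE (ball x0 r `*` ball c r).
  by apply: sub_sigma_algebra; exists (ball x0 r), (ball c r).
have law1 : same_law normE P2 (X \o fst) P X by exact: PfstE.
have law2 : same_law normE P2 (X \o snd) P X by exact: PsndE.
have := HG rv1 rv2 law1 law2 ind (orthonormal_shear a1) mC.
rewrite (_ : _ @^-1` _ = (X @^-1` ball x0 r) `*`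
    (((fun y => a *: x0 + y) \o X) @^-1` ball c r)); last first.
  apply/seteqP; split=> -[w1 w2] /=; rewrite /uball /= scale1r scale0r addr0 scale1r.
    move=> [xw cw]; split=> //; apply: (dist_lt_trans HN cw).
    rewrite opprD addrACA subrr addr0 -scalerBr (normZ HN).
    apply: le_lt_trans (_ : normE (X w1 - x0) < r).
      by rewrite ler_piMl// (norm_ge0 HN).
    by rewrite (norm_distC HK HN).
  move=> [xw cw]; split=> //; apply: (dist_lt_trans HN cw).
  rewrite opprD addrACA subrr addr0 -scalerBr (normZ HN).
  by apply: le_lt_trans xw; rewrite ler_piMl// (norm_ge0 HN).
rewrite (_ : (fun _ => _) @^-1` _ =
    (X @^-1` ball x0 r) `*` (X @^-1` ball c r)); last first.
  by apply/seteqP; split=> -[].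
have mB : measurable (X @^-1` ball x0 r) by exact: mX.
have mB' : measurable (X @^-1` ball c r) by exact: mX.
have mB'' : measurable (((fun y => a *: x0 + y) \o X) @^-1` ball c r).
  exact: (mX (borel_translate _ (mb c r))).
rewrite !P2E//.
(* The common factor is positive because [x0] is in the support, so it cancels. *)
move=> eqP2; have PB_gt0 : (0 < P (X @^-1` ball x0 r))%E.
  by apply: sx0; [exact: (mopen_uball HN)|exact: (uball_center HN)].
have PB_fin : P (X @^-1` ball x0 r) \is a fin_num by exact: fin_num_measure.
apply/eqP; rewrite eq_le -(lee_pmul2l PB_fin PB_gt0) eqP2 lexx /=.
by rewrite -(lee_pmul2l PB_fin PB_gt0) eqP2.
Qed.

(** * The support: full mass, module structure, singular translates, Haar property *)

Lemma mclosed_support : mclosed (distE normE) supp.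
Proof.
move=> x sx; have [U [oU Ux nU]] :
    exists U, [/\ mopen (distE normE) U, U x & ~ (0 < law P X U)%E].
  apply: contrapT => nex; apply: sx => U oU Ux.
  by apply: contrapT => nU; apply: nex; exists U.
have [r [r0 hr]] := oU _ Ux.
by exists r; split=> // y xy sy; apply: nU; apply: sy => //; exact: hr.
Qed.

Lemma borel_support : borelE normE supp.
Proof. exact: (mborel_closed mclosed_support). Qed.

(** Each point off the support has a null neighbourhood, and a countable base leaves only countably
    many null sets to unite. *)
Lemma law_supportC : P (X @^-1` (~` supp)) = 0%E.
Proof.
have [B [hB base]] := countable_base HK HN HS.
have mB k : borelE normE (B k).
  case: (hB k) => [->|[c [r ->]]]; last exact: (borel_uball HN).
  exact: sigma_algebra0.
pose F k := if P (X @^-1` B k) == 0%E then X @^-1` B k else set0.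
apply: measure_negligible; first by apply: mX; apply: mborelC; exact: borel_support.
apply: (@negligibleS _ _ _ _ (\bigcup_k F k)); last first.
  apply: negligible_bigcup => k; rewrite /F; case: eqP => Bk.
    by apply/negligibleP => //; exact: mX.
  exact: negligible_set0.
move=> w sw; have [U [oU Uw nU]] : exists U,
    [/\ mopen (distE normE) U, U (X w) & ~ (0 < law P X U)%E].
  apply: contrapT => nex; apply: sw => U oU Ux.
  by apply: contrapT => nU; apply: nex; exists U.
have [k [kw kU]] := base _ _ oU Uw.
exists k => //; rewrite /F ifT//.
rewrite eq_le measure_ge0 andbT leNgt; apply/negP => Bk; apply: nU.
apply: lt_le_trans Bk _; apply: le_measure; rewrite ?inE.
- exact: mX.
- by apply: mX; exact: mborel_open.
- by move=> v /kU.
Qed.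

Lemma law_support : P (X @^-1` supp) = 1%E.
Proof.
have mS := mX borel_support.
have := law_supportC; rewrite -preimage_setC probability_setC//.
have fS : P (X @^-1` supp) \is a fin_num by exact: fin_num_measure.
by rewrite -(fineK fS) => -[] /eqP; rewrite subr_eq0 => /eqP <-.
Qed.

Lemma support_neq0 : exists x, supp x.
Proof.
apply: contrapT => s0; have := law_support.
rewrite (_ : X @^-1` supp = set0) ?measure0; last first.
  by apply/seteqP; split=> // w sw; apply: s0; exists (X w).
by move=> [] /eqP; rewrite eq_sym oner_eq0.
Qed.

Lemma support_translate g y :
  same_law normE P (fun w => g + X w) P X -> supp y -> supp (g + y).
Proof.
move=> gX sy U oU Ugy; rewrite -gX; last exact: mborel_open.
apply: (sy [set z | U (g + z)]) => // z /oU[r [r0 hr]].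
exists r; split=> // v zv; apply: hr.
by rewrite /distE opprD addrACA subrr add0r.
Qed.

Lemma support_invariant x : supp x -> same_law normE P (fun w => x + X w) P X.
Proof.
move=> sx; rewrite -[x]scale1r.
by apply: (support_scale_invariant sx); rewrite abs1.
Qed.

Lemma support0 : supp 0.
Proof.
have [s ss] := support_neq0; rewrite -(addNr s) -scaleN1r.
apply: support_translate => //.
by apply: support_scale_invariant => //; rewrite absN1.
Qed.

Lemma submodule_support : D_submodule absK supp.
Proof.
split; first exact: support0.
split=> [x y sx sy|a x a1 sx]; first exact/support_translate/sy/support_invariant.
rewrite -[_ *: _]addr0; apply: support_translate support0.
exact: support_scale_invariant.
Qed.

Let supportN x : supp x -> supp (- x).
Proof.
case: submodule_support => _ [_ sZ] sx.
by rewrite -scaleN1r; apply: sZ => //; rewrite absN1.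
Qed.

Let supportB x y : supp x -> supp y -> supp (x - y).
Proof. exact: (submoduleB HL submodule_support). Qed.

(** The support itself separates the laws: if x + X and X were both in this group, so would be x. *)
Lemma support_singular x : ~ supp x ->
  mutually_singular normE (law P (fun w => x + X w)) (law P X).
Proof.
move=> sx; exists supp; split; [exact: borel_support|split]; last first.
  exact: law_supportC.
apply: (measure_negligible (mX (borel_translate _ borel_support))).
exists (X @^-1` (~` supp)); split; last 2 first.
- exact: law_supportC.
- move=> w sxw sw; apply: sx.
  by rewrite -(addrK (X w) x); exact: supportB.
- by apply: mX; apply: mborelC; exact: borel_support.
Qed.

Lemma support_haar : is_normalised_haar_on normE P X supp.
Proof.
split; first exact: law_support.
(* Invariance is applied to [- s], since X lies in s + B exactly when - s + X lies in B. *)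
move=> s ss B mB _; rewrite -(support_invariant (supportN ss) mB).
congr (P _); apply/seteqP; split=> w /=; rewrite /preimage /=.
  by move=> [b Bb <-]; rewrite addKr.
by move=> Bw; exists (- s + X w) => //; rewrite addNKr.
Qed.

(** * Compactness of the support *)

Lemma law_ball_support s r : supp s -> P (X @^-1` ball s r) = P (X @^-1` ball 0 r).
Proof.
move=> ss; rewrite -[LHS](support_invariant ss (borel_uball HN s r)).
congr (P _); apply/seteqP; split=> w; rewrite /preimage /uball /=.
  by rewrite opprD addrA subrr.
by rewrite opprD addrA subrr.
Qed.

(* A point of the support outside the first balls of an exhausting sequence keeps
   the mass of a whole ball out of their union. *)
Lemma support_totally_bounded (u : nat -> E) r : 0 < r ->
  (forall x, exists n, ball (u n) r x) ->
  exists N, forall s, supp s -> exists n, (n < N)%N /\ ball (u n) r s.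
Proof.
move=> r0 hu; apply: contrapT => nex.
pose U N := \bigcup_(n in `I_N) (X @^-1` ball (u n) r).
have mball c : measurable (X @^-1` ball c r).
  by apply: mX; exact: (borel_uball HN).
have mU N : measurable (U N) by apply: bigcup_measurable => n _.
have UT : \bigcup_N U N = setT.
  apply/seteqP; split=> // w _; have [n nw] := hu (X w).
  by exists n.+1 => //; exists n => /=.
have c_gt0 : (0 < P (X @^-1` ball 0 r))%E.
  apply: support0; [exact: (mopen_uball HN)|exact: (uball_center HN)].
have leU N : (P (U N) <= 1 - P (X @^-1` ball 0 r))%E.
  have [s [ss hs]] : exists s, supp s /\ forall n, (n < N)%N -> ~ ball (u n) r s.
    apply: contrapT => ns; apply: nex; exists N => s ss.
    apply: contrapT => nn; apply: ns; exists s; split=> // n nN ns.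
    by apply: nn; exists n.
  rewrite -(law_ball_support _ ss) -probability_setC//.
  apply: le_measure; rewrite ?inE//; first exact: measurableC.
  move=> w [n nN nw] sw; apply: (hs _ nN).
  apply: (dist_lt_trans HN nw).
  by rewrite (norm_distC HK HN).
have cvU : (P \o U) x @[x --> \oo] --> P (\bigcup_N U N).
  apply: nondecreasing_cvg_mu => //; first by rewrite UT.
  move=> m n mn; apply/subsetPset; apply: bigcup_subset.
  by move=> k /= km; exact: leq_trans km mn.
have : (lim ((P \o U) x @[x --> \oo]) <= 1 - P (X @^-1` ball 0 r))%E.
  apply: lime_le; first by apply/cvg_ex; eexists; exact: cvU.
  by apply: nearW => N; exact: leU.
rewrite (cvg_lim _ cvU)// UT probability_setT.
have fc : P (X @^-1` ball 0 r) \is a fin_num by exact: fin_num_measure.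
move: c_gt0; rewrite -(fineK fc) lte_fin => c_gt0.
by rewrite lee_fin lerBrDr gerDl leNgt c_gt0.
Qed.

Lemma support_compact : mcompact (distE normE) supp.
Proof.
have [u hu] := HS; have [_ [cE _]] := HE.
apply: (totally_bounded_compact HK HN (u := u)) => //; first exact: mclosed_support.
move=> r r0; apply: support_totally_bounded => // x.
by have [n xn] := hu x _ r0; exists n; rewrite /uball /= (norm_distC HK HN).
Qed.

(** * Identification of S with the support, and the zero-one law *)

Lemma gaussS_support : gaussS absK normE P X = supp.
Proof.
have mT : (0 < P [set: Om])%E by rewrite probability_setT.
apply/seteqP; split=> x; last first.
  move=> sx T [Tlin Tcont]; rewrite leNgt; apply/negP => ltT.
  have sup_ge0 : (0 <= ess_sup P (fun w => (absK (T (X w)))%:E))%E.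
    by apply: ess_sup_gee => //; apply: nearW => w; rewrite lee_fin abs_ge0.
  have Tx_gt0 : 0 < absK (T x) by rewrite -lte_fin (le_lt_trans sup_ge0).
  (* An open neighbourhood of [x] on which |T| exceeds its essential supremum, hence null. *)
  pose U := [set y | absK (T x) <= absK (T y)].
  have oU : mopen (distE normE) U.
    move=> y Uy; have [del [del0 hdel]] := Tcont y _ Tx_gt0.
    by exists del; split=> // z /hdel; exact: abs_ge_near Uy.
  have := sx U oU (lexx _); rewrite /law.
  suff -> : P (X @^-1` U) = 0%E by rewrite ltxx.
  apply: measure_negligible; first by apply: mX; exact: mborel_open.
  apply: negligibleS (ess_sup_ge P (fun w => (absK (T (X w)))%:E)).
  move=> w Uw /= le_sup; have := lt_le_trans ltT (_ : _ <= (absK (T (X w)))%:E)%E.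
  by rewrite lee_fin => /(_ Uw); rewrite ltNge le_sup.
move=> Sx; apply: contrapT => sx.
have [e [e0 he]] := mclosed_support sx.
(* Thickening the support by the radius of a ball around [x] that misses it gives an open D-module
   that still avoids [x]. *)
pose V := [set y | exists2 s, supp s & normE (y - s) < e].
have [s0 [sD sZ]] := submodule_support.
have mV : D_submodule absK V.
  split; first by exists 0 => //; rewrite subrr (norm0 HN).
  split=> [y z [s ss ys] [t st zt]|a y a1 [s ss ys]].
    exists (s + t); first exact: sD.
    by rewrite opprD addrACA; exact: (normD_lt HN).
  exists (a *: s); first exact: sZ.
  rewrite -scalerBr (normZ HN); apply: le_lt_trans ys.
  by rewrite ler_piMl// (norm_ge0 HN).
have [||T [Td Tx TV]] := submodule_separation HL HN mV e0 (x := x).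
- by move=> y ye; exists 0; rewrite ?subr0.
- by move=> [s ss xs]; exact: (he s).
have [p [/andP[p0 p1] p_unif]] := exists_uniformizer HL.
(* The strict bound |T| < 1 might be lost in a supremum; discreteness of the value group sharpens it
   to |p| < 1. *)
have sup_le : (ess_sup P (fun w => (absK (T (X w)))%:E) <= (absK p)%:E)%E.
  apply/ess_supP; exists (X @^-1` (~` supp)); split.
  - by apply: mX; apply: mborelC; exact: borel_support.
  - exact: law_supportC.
  - move=> w /= nle sw; apply: nle; rewrite lee_fin; apply/p_unif/TV.
    by exists (X w) => //; rewrite subrr (norm0 HN).
have := le_trans (Sx T Td) sup_le.
by rewrite Tx abs1// lee_fin leNgt p1.
Qed.

Lemma law_subspace_support M : measurable_vsubspace normE M ->
  (supp `<=` M -> P (X @^-1` M) = 1%E) /\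
  (~ (supp `<=` M) -> P (X @^-1` M) = 0%E).
Proof.
move=> [M0 [Mlin mM]]; have mXM := mX mM; split=> [SM|SM].
  apply/eqP; rewrite eq_le probability_le1//= -law_support.
  apply: le_measure; rewrite ?inE//; first exact: mX borel_support.
  by move=> w /SM.
have [s [ss Ms]] : exists s, supp s /\ ~ M s.
  apply: contrapT => ns; apply: SM => s ss.
  by apply: contrapT => Ms; apply: ns; exists s.
have [p /andP[p0 p1]] := exists_abs_lt1 HL.
have [_ [_ sZ]] := submodule_support.
have sp n : supp (- (p ^+ n *: s)).
  by apply: supportN; apply: sZ => //; rewrite absX// exprn_ile1// ltW.
(* These events have the probability of [M] by invariance. They are disjoint: a common point would
   put (p^j - p^i) s, hence s, in [M]. *)
pose F n := [set w | M (- (p ^+ n *: s) + X w)].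
apply: (trivIset_same_probability (F := F)).
- by move=> n; exact: (mX (borel_translate _ mM)).
- move=> i j _ _ [w [Mi Mj]]; apply: contrapT => ij; apply: Ms.
  have pij : p ^+ j - p ^+ i != 0.
    rewrite subr_eq0; apply/eqP => /(congr1 absK); rewrite !absX// => pp.
    by move/(ieexprIn p0 (negbT (lt_eqF p1))) : pp => /esym/ij.
  have : M ((p ^+ j - p ^+ i)^-1 *:
      (- 1 *: (- (p ^+ j *: s) + X w) + (- (p ^+ i *: s) + X w)) + 0).
    exact: Mlin (Mlin _ _ _ Mj Mi) M0.
  rewrite addr0 scaleN1r opprD opprK addrACA addNr addr0 -scalerBl scalerA.
  by rewrite mulVf// scale1r.
- by move=> n; exact: (support_invariant (sp n) mM).
Qed.

End GaussianLaw.

Theorem theorem4p6 (R : realType) (K : fieldType) (absK : K -> R)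
  (HK : local_field absK)
  (E : lmodType K) (normE : E -> R) (HE : separable_banach absK normE)
  (d : measure_display) (Om : measurableType d) (P : probability Om R)
  (X : Om -> E) (HX : random_var normE X) (HG : K_gaussian absK normE P X) :
  (* (i) *)
  D_submodule absK (gaussS absK normE P X) /\
  (* (ii) *)
  (forall x : E,
     (gaussS absK normE P X x ->
        same_law normE P (fun w => x + X w) P X) /\
     (~ gaussS absK normE P X x ->
        mutually_singular normE (law P (fun w => x + X w)) (law P X))) /\
  (* (iii) *)
  closed_support normE P X = gaussS absK normE P X /\
  (* (iv) *)
  mcompact (distE normE) (gaussS absK normE P X) /\
  (* (v) *)
  is_normalised_haar_on normE P X (gaussS absK normE P X) /\
  (* (vi) *)
  (forall M : set E, measurable_vsubspace normE M ->
     (gaussS absK normE P X `<=` M -> P (X @^-1` M) = 1%E) /\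
     (~ (gaussS absK normE P X `<=` M) -> P (X @^-1` M) = 0%E)).
Proof.
have HS := gaussS_support HK HE HX HG; rewrite HS.
split; first exact: (submodule_support HK HE HX HG).
split; first by move=> x; split;
  [exact: (support_invariant HK HE HX HG)|exact: (support_singular HK HE HX HG)].
split; first by [].
split; first exact: (support_compact HK HE HX HG).
split; first exact: (support_haar HK HE HX HG).
exact: (law_subspace_support HK HE HX HG).
Qed.
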